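(* Let $\mathbf{n}=(n_1,\dots,n_m)$ be integers with $n_1\ge n_2\ge\cdots\ge n_m\ge2$, and let $\mathbb{L}/\mathbb{K}$ be a Galois extension whose Galois group $G$ is generated by commuting $\theta_1,\dots,\theta_m$ such that $\mathbf{i}\mapsto\boldsymbol\theta^{\mathbf{i}}$ is a bijection $\Delta(\mathbf{n})\to G$ (so $G\cong\mathbb{Z}/n_1\mathbb{Z}\times\cdots\times\mathbb{Z}/n_m\mathbb{Z}$). Let $P\in\mathbb{L}[G]$ be nonzero. Then \[\mathrm{rk}_\mathbb{K}(P)\ \ge\ \min\Big\{\prod_{i=1}^m(n_i-u_i)\ :\ \mathbf{u}\in\Delta(\mathbf{n}),\ |\mathbf{u}|=\deg_{\boldsymbol\theta}(P)\Big\}=(n_s-\ell)\prod_{i=1}^{s-1}n_i,\] where $s\in\{1,\dots,m\}$ and $0\le\ell<n_s$ are integers with $\deg_{\boldsymbol\theta}(P)=\sum_{i=s+1}^m(n_i-1)+\ell$ (the value $(n_s-\ell)\prod_{i<s}n_i$ does not depend on the choice of such $(s,\ell)$).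
   Context: $\Delta(t)=\{0,1,\dots,t-1\}$, $\Delta(\mathbf{n})=\Delta(n_1)\times\cdots\times\Delta(n_m)$, $\boldsymbol\theta^{\mathbf{i}}=\theta_1^{i_1}\circ\cdots\circ\theta_m^{i_m}$, $|\mathbf{i}|=i_1+\cdots+i_m$. Every $P\in\mathbb{L}[G]$ is uniquely $P=\sum_{\mathbf{i}\in\Delta(\mathbf{n})}b_\mathbf{i}\boldsymbol\theta^\mathbf{i}$ with $b_\mathbf{i}\in\mathbb{L}$, and for $P\ne0$, $\deg_{\boldsymbol\theta}(P)=\max\{|\mathbf{i}|:b_\mathbf{i}\neq0\}$. $P$ acts on $\mathbb{L}$ as the $\mathbb{K}$-linear map $x\mapsto\sum b_\mathbf{i}\boldsymbol\theta^\mathbf{i}(x)$, and $\mathrm{rk}_\mathbb{K}(P)$ is its rank. *)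

(* Defs.v *)
From HB Require Import structures.
From mathcomp Require Import all_boot all_order all_algebra all_fingroup all_field.
Set Implicit Arguments. Unset Strict Implicit. Unset Printing Implicit Defensive.
Import GRing.Theory.
Local Open Scope ring_scope.

Definition Delta (m : nat) (n : 'I_m -> nat) : finType :=
  {dffun forall j : 'I_m, 'I_(n j)}.

Definition absidx (m : nat) (n : 'I_m -> nat) (i : Delta n) : nat :=
  (\sum_(j < m) (i j : nat))%N.

Section Gal.
Variables (F : fieldType) (L : splittingFieldType F).

Definition thetaPow (m : nat) (n : 'I_m -> nat) (th : 'I_m -> gal_of {:L})
    (i : Delta n) : gal_of {:L} :=
  (\prod_(j < m) (th j ^+ (i j : nat)))%g.

(* the action of P = sum_{g in G} P(g) g  (an element of L[G]) on L *)
Definition actL (P : {ffun gal_of {:L} -> L}) (x : L) : L :=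
  \sum_(g in ('Gal({:L} / 1%AS))%g) P g * g x.

Definition rkK (P : {ffun gal_of {:L} -> L}) : nat :=
  \dim (limg (linfun (actL P))).

Definition degTheta (m : nat) (n : 'I_m -> nat) (th : 'I_m -> gal_of {:L})
    (P : {ffun gal_of {:L} -> L}) : nat :=
  (\max_(i : Delta n | P (thetaPow th i) != 0%R) absidx i)%N.
End Gal.

Arguments degTheta {F L m} n th P.

(* min { prod_i (n_i - u_i) : u in Delta(n), |u| = d };
   the default value prod_i n_i is >= every candidate, and the index set is
   nonempty whenever d <= sum_i (n_i - 1), so this is the true minimum. *)
Definition minProd (m : nat) (n : 'I_m -> nat) (d : nat) : nat :=
  (\big[minn/(\prod_(j < m) n j)]_(u : Delta n | absidx u == d)
      \prod_(j < m) (n j - u j))%N.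

(* Main.v *)
Require Import Defs.
From HB Require Import structures.
From mathcomp Require Import all_boot all_order all_algebra all_fingroup all_field.
From mathcomp Require Import all_solvable all_character zify.
Import GRing.Theory Num.Theory.
Set Implicit Arguments. Unset Strict Implicit. Unset Printing Implicit Defensive.

(** The hypotheses do not say that [th j ^+ n j = 1], only that the box [Delta n]
    tiles the Galois group [G].  By Hajos' theorem (in a form relative to a
    subgroup) the indices can nevertheless be enumerated so that the box over each
    initial segment fills the subgroup which that segment generates.  Order
    exponents lexicographically along this enumeration, and let [u] be the leading
    exponent of [P].  For [v >= u] the composite of [theta^(v - u)] with [P] has
    leading exponent [v], so these [\prod_j (n j - u j)] composites are
    [L]-independent, and the rank of [P] is at least their number.  Finally
    [absidx u <= degTheta n th P], and the minimum is found by exchanging units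
    between factors.

    Hajos' theorem is proved on the dual group: a nontrivial character kills one
    of the cyclic factors, so the sets of characters killing a given factor cover
    the dual group, and counting prime factors of indices (with multiplicity)
    shows that an irredundant cover of this kind must be large. *)

(** * Prime factors and covers by cosets *)

Section BigOmega.

(** The number of prime factors of [n] counted with multiplicity, as [logn p n] is 0 unless [p] is
    prime. *)
Definition Omega (n : nat) : nat := \sum_(p < n.+1) logn p n.

Lemma Omega_wide (B n : nat) : n < B -> \sum_(p < B) logn p n = Omega n.
Proof.
move=> ltnB; rewrite /Omega -!(big_mkord xpredT (fun p => logn p n)).
rewrite (big_cat_nat _ (n := n.+1)) //= [X in _ + X]big_nat_cond.
by rewrite [X in _ + X]big1 ?addn0 // => p /andP[/andP[ltnp _] _]; rewrite ltn_log0.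
Qed.

Lemma OmegaM (m n : nat) : 0 < m -> 0 < n -> Omega (m * n) = Omega m + Omega n.
Proof.
move=> m0 n0; rewrite -(@Omega_wide (m * n).+1 m) ?ltnS ?leq_pmulr //.
rewrite -(@Omega_wide (m * n).+1 n) ?ltnS ?leq_pmull //.
by rewrite -big_split; apply: eq_bigr => p _; rewrite lognM.
Qed.

Lemma Omega1 : Omega 1 = 0.
Proof. by rewrite /Omega big1 // => p _; rewrite logn1. Qed.

Lemma Omega_prime (p : nat) : prime p -> Omega p = 1.
Proof.
move=> pr_p; rewrite /Omega big_ord_recr /= logn_prime // eqxx big1 // => q _.
by rewrite logn_prime // ltn_eqF.
Qed.

Lemma Omega_gt0 (n : nat) : 1 < n -> 0 < Omega n.
Proof.
move=> n1; have ltp : pdiv n < n.+1 by rewrite ltnS pdiv_leq // ltnW.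
rewrite /Omega (bigD1 (Ordinal ltp)) //= ltn_addr // logn_gt0.
by rewrite mem_primes pdiv_prime // pdiv_dvd ltnW.
Qed.

Lemma Omega_dvd_leq (m n : nat) : 0 < n -> m %| n -> Omega m <= Omega n.
Proof.
move=> n0 /dvdnP[k Dn]; move: n0; rewrite Dn muln_gt0 => /andP[k0 m0].
by rewrite OmegaM // leq_addl.
Qed.

Lemma Omega_dvd_eq (m n : nat) : 0 < n -> m %| n -> Omega n <= Omega m -> m = n.
Proof.
move=> n0 /dvdnP[k Dn]; move: n0; rewrite Dn muln_gt0 => /andP[k0 m0].
rewrite OmegaM // -subn_eq0 addnK => /eqP Ok; case: k {Dn} k0 Ok => // -[|k] _.
  by rewrite mul1n.
by move=> Ok; have := @Omega_gt0 k.+2 isT; rewrite Ok.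
Qed.

Lemma Omega_prod (I : finType) (A : {pred I}) (n : I -> nat) :
  (forall i, 0 < n i) -> Omega (\prod_(i in A) n i) = \sum_(i in A) Omega (n i).
Proof.
move=> n0; have [] : 0 < \prod_(i in A) n i /\
    Omega (\prod_(i in A) n i) = \sum_(i in A) Omega (n i); last by [].
elim/big_rec2: _ => [|i m k _ [k0 <-]]; first by rewrite Omega1.
by rewrite muln_gt0 n0 k0 OmegaM.
Qed.

End BigOmega.

(** * Irredundant covers of a coset by weighted sets *)

Section CosetCover.
Local Open Scope group_scope.
Variables (xT : finGroupType) (I : finType).
Implicit Types (Y V : {group xT}) (S T : {set I}).

Lemma Omega_index_trans (G H K : {group xT}) :
  H \subset G -> K \subset H -> Omega #|G : K| = (Omega #|G : H| + Omega #|H : K|)%N.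
Proof. by move=> sHG sKH; rewrite -(Lagrange_index sHG sKH) OmegaM ?indexg_gt0. Qed.

Lemma Omega_index_sub (G H K : {group xT}) :
  H \subset G -> K \subset H -> (Omega #|G : H| <= Omega #|G : K|)%N.
Proof. by move=> sHG sKH; rewrite (Omega_index_trans sHG sKH) leq_addr. Qed.

Variables (D : I -> {set xT}) (N : I -> {group xT}) (w : I -> nat).

(** Each [D i] is a union of cosets of [N i], of weight [w i]. [D_coset] is the bound for a cover by
    a single set. By [D_escape], a coset meeting [D i] without lying in it contains a smaller coset
    that avoids [D i]; the index costs one prime factor, or at most [w i] of them if the smaller
    subgroup lies in [N i]. *)
Hypothesis D_stable : forall i x z, x \in D i -> z \in N i -> x * z \in D i.
Hypothesis D_coset : forall i Y x, x *: Y \subset D i -> (Omega #|Y : Y :&: N i| < w i)%N.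
Hypothesis D_escape : forall i Y x,
  ~~ (x *: Y \subset D i) -> ~~ [disjoint x *: Y & D i] ->
  exists V : {group xT}, exists2 y, y \in x *: Y &
    [/\ V \subset Y, [disjoint y *: V & D i] &
        prime #|Y : V| \/ V \subset N i /\ (Omega #|Y : V| <= w i)%N].

Definition covers T (A : {set xT}) := A \subset \bigcup_(i in T) D i.

Definition irredundant T (A : {set xT}) :=
  covers T A /\ forall i, i \in T -> ~~ covers (T :\ i) A.

Lemma coversS S T (A : {set xT}) : S \subset T -> covers S A -> covers T A.
Proof.
move=> sST covS; apply: subset_trans covS _; apply/bigcupsP=> i Si.
by apply: bigcup_sup; apply: (subsetP sST).
Qed.

Lemma covers_sub T (A B : {set xT}) : A \subset B -> covers T B -> covers T A.
Proof. exact: subset_trans. Qed.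

Lemma irredundant_exists T (A : {set xT}) :
  covers T A -> exists2 S : {set I}, S \subset T & irredundant S A.
Proof.
move=> covT; have [S /minsetP[covS minS] sST] := minset_exists (P := covers^~ A) covT.
exists S => //; split=> // i Si; apply/negP=> covSi.
by have := minS _ covSi (subD1set _ _) => /setP/(_ i); rewrite !inE eqxx Si.
Qed.

Lemma irredundant_neq0 T Y x : irredundant T (x *: Y) -> T != set0.
Proof.
case=> covT _; apply: contraTneq covT => ->; rewrite /covers big_set0.
by apply/subsetPn; exists x; rewrite ?lcoset_refl ?inE.
Qed.

Lemma covers_avoid S T (A : {set xT}) :
  covers T A -> {in S, forall i, [disjoint A & D i]} -> covers (T :\: S) A.
Proof.
move=> /subsetP covT dis; apply/subsetP=> x Ax; have /bigcupP[i Ti Dix] := covT x Ax.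
apply/bigcupP; exists i => //; rewrite inE Ti andbT; apply: contraL Dix => Si.
by rewrite (disjointFr (dis i Si) Ax).
Qed.

Let NT S : {set xT} := \bigcap_(i in S) N i.

(* The covering argument behind Hajos' theorem: grow a set [S] of used indices,
   starting from a coset that avoids one of the sets.  A point of [x *: Y] missed
   by [S] has its whole coset modulo [Y :&: NT S] missed by [S], and this coset
   has a smaller irredundant cover. *)
Lemma Omega_irredundant_cover T Y x :
  irredundant T (x *: Y) -> (Omega #|Y : Y :&: NT T| < \sum_(i in T) w i)%N.
Proof.
have [c] := ubnP #|T|; elim: c T Y x => // c IHc T Y x leTc irrT.
have [covT minT] := irrT.
(* Every enlargement of [S] makes the bound strict, since the cover [R] of the missed coset
   satisfies it strictly by induction on [#|T|]. So strictness is assumed only when [S] is already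
   [T]. *)
have grow S : S \subset T -> S != set0 -> (S == T -> Omega #|Y : Y :&: NT S| < \sum_(i in S) w i)%N ->
    (Omega #|Y : Y :&: NT S| <= \sum_(i in S) w i)%N ->
    (Omega #|Y : Y :&: NT T| < \sum_(i in T) w i)%N.
  have [d] := ubnP #|T :\: S|; elim: d S => // d IHd S leTSd sST S0 eqS leS.
  have [eST | neST] := eqVneq S T; first by rewrite -eST eqS ?eST.
  have [j Tj Sj] : exists2 j, j \in T & j \notin S.
    by apply/subsetPn; apply: contra neST; rewrite eqEsubset sST.
  have [z xYz zS] : exists2 z, z \in x *: Y & z \notin \bigcup_(i in S) D i.
    apply/subsetPn; apply: contra (minT j Tj); apply: coversS.
    by apply/subsetP=> i Si; rewrite !inE (subsetP sST) // andbT; apply: contraNneq Sj => <-.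
  pose Z := [group of Y :&: NT S].
  have sZx : z *: Z \subset x *: Y.
    by rewrite -(lcoset_eqP xYz) mulgS // subsetIl.
  have disZ : {in S, forall i, [disjoint z *: Z & D i]}.
    move=> i Si; rewrite disjoint_subset; apply/subsetP=> y /lcosetP[v].
    rewrite inE => /andP[_ /bigcapP/(_ i Si) Niv] ->; rewrite inE.
    apply: contra zS => Dzv; apply/bigcupP; exists i => //.
    by rewrite -(mulgK v z) D_stable ?groupV.
  have covZ := covers_avoid (covers_sub sZx covT) disZ.
  have [R sRTS irrR] := irredundant_exists covZ.
  have [sRT disRS] : R \subset T /\ [disjoint R & S] by apply/andP; rewrite -subsetD.
  have ltRc : (#|R| < c)%N.
    rewrite -ltnS; apply: leq_trans leTc; rewrite ltnS.
    rewrite -(cardsID S T) (setIidPr sST) -(add1n #|R|) leq_add ?card_gt0 //.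
    exact: subset_leq_card.
  have OR := IHc R Z z ltRc irrR.
  have R0 := irredundant_neq0 irrR.
  have disSR : [disjoint S & R] by rewrite disjoint_sym.
  have wSR : \sum_(i in S :|: R) w i = (\sum_(i in S) w i + \sum_(i in R) w i)%N.
    by rewrite (eq_bigl [predU S & R]) ?bigU //= => i; rewrite !inE.
  have NSR : Y :&: NT (S :|: R) = Z :&: NT R.
    by rewrite /NT bigcap_setU setIA.
  have OSR : (Omega #|Y : Y :&: NT (S :|: R)| < \sum_(i in S :|: R) w i)%N.
    rewrite NSR (@Omega_index_trans Y Z [group of Z :&: NT R]) ?subsetIl // wSR.
    by rewrite -addnS leq_add.
  apply: (IHd (S :|: R)) => //; last exact: ltnW; last by rewrite setU_eq0 negb_and S0.
    rewrite -ltnS; apply: leq_trans leTSd; rewrite ltnS; apply: proper_card.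
    rewrite setDUr properE subsetIl /=; have [i Ri] := set0Pn _ R0.
    apply/subsetPn; exists i; first exact: (subsetP sRTS).
    by rewrite !inE Ri andbF.
  by rewrite subUset sST.
have /set0Pn[i Ti] := irredundant_neq0 irrT.
have [sD | nsD] := boolP (x *: Y \subset D i).
  have -> : T = [set i].
    apply/eqP; rewrite eqEsubset sub1set Ti andbT; apply/subsetP=> j Tj; rewrite inE.
    apply: contraT => neji; have /negP[] := minT j Tj; apply: subset_trans sD _.
    by apply: bigcup_sup; rewrite !inE eq_sym neji.
  by rewrite /NT !big_set1 (D_coset sD).
have meetD : ~~ [disjoint x *: Y & D i].
  apply/negP=> dis; have /negP[] := minT i Ti; apply: covers_avoid covT _.
  by move=> j; rewrite inE => /eqP->.
have [V [y xYy [sVY disV caseV]]] := D_escape nsD meetD.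
have sVx : y *: V \subset x *: Y by rewrite -(lcoset_eqP xYy) mulgS.
have covV : covers (T :\ i) (y *: V).
  by apply: covers_avoid (covers_sub sVx covT) _ => j; rewrite inE => /eqP->.
have [R sRT' irrR] := irredundant_exists covV.
have /subsetD1P[sRT iR] := sRT'.
have ltRc : (#|R| < c)%N.
  rewrite -ltnS; apply: leq_trans leTc; rewrite ltnS proper_card // properE sRT.
  by apply/subsetPn; exists i.
have OR := IHc R V y ltRc irrR.
have R0 := irredundant_neq0 irrR.
have OYV : Omega #|Y : V :&: NT R| = (Omega #|Y : V| + Omega #|V : V :&: NT R|)%N.
  by rewrite -(@Omega_index_trans Y V [group of V :&: NT R]) ?subsetIl.
(* For a prime index, the extra prime factor uses up the strictness for [R], so [grow] starts from
   the weak bound; [R] omits [i] and hence is not [T]. Otherwise [V] lies in [N i], so [i] can be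
   joined to [R], and [w i] pays for the index of [V]. *)
case: caseV => [prV | [sVN OV]].
  apply: (grow R) => //; first by move=> /eqP eRT; rewrite eRT Ti in iR.
  apply: leq_trans (@Omega_index_sub Y [group of Y :&: NT R] [group of V :&: NT R] _ _) _.
  - exact: subsetIl.
  - exact: setSI.
  by rewrite OYV Omega_prime.
have wiR : \sum_(j in i |: R) w j = (w i + \sum_(j in R) w j)%N by rewrite big_setU1.
have OiR : (Omega #|Y : Y :&: NT (i |: R)| < \sum_(j in i |: R) w j)%N.
  rewrite wiR; apply: leq_ltn_trans (@Omega_index_sub Y [group of Y :&: NT (i |: R)] [group of V :&: NT R] _ _) _.
  - exact: subsetIl.
  - by rewrite /= /NT bigcap_setU big_set1 subsetI subIset ?sVY //= subsetI subIset ?sVN //= subsetIr.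
  by rewrite OYV -addnS leq_add.
apply: (grow (i |: R)) => //; last exact: ltnW; first by rewrite subUset sub1set Ti.
by rewrite setU_eq0 negb_and R0 orbT.
Qed.

End CosetCover.

(** * Characters of a finite abelian group *)

Section CosetShapes.
Local Open Scope group_scope.
Variable xT : finGroupType.
Hypothesis abX : abelian [set: xT].
Implicit Types (Y V W M N : {group xT}).

Let abT Y : abelian Y. Proof. exact: abelianS (subsetT Y) abX. Qed.

Lemma abelian_prime_index_above Y W : W \proper Y ->
  exists V : {group xT}, [/\ W \subset V, V \subset Y & prime #|Y : V|].
Proof.
move=> ltWY; have sWY := proper_sub ltWY.
have nWY : W <| Y by rewrite -sub_abelian_normal.
have solQ : solvable (Y / W) by rewrite abelian_sol // quotient_abelian.
have ntQ : Y / W != 1.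
  by rewrite -subG1 quotient_sub1 ?normal_norm //; case/andP: ltWY.
have [Hb nHb prHb] := sol_prime_factor_exists solQ ntQ.
have [V defHb sWV sVY] := inv_quotientN nWY nHb.
exists V; split=> //; rewrite ?normal_sub //.
suff <- : #|Y / W : V / W| = #|Y : V| by rewrite -defHb.
apply: index_quotient_eq; last exact: normal_norm; last exact: normal_sub.
by rewrite subIset // sWV orbT.
Qed.

(** If [x *: Y] meets [W], it does so in one coset of [Y :&: W], which lies in a single coset of
    [V]; any other coset of [V] in [x *: Y] avoids [W]. *)
Lemma lcoset_meet_in Y W V x : Y :&: W \subset V -> V \proper Y ->
  exists2 y, y \in x *: Y & [disjoint y *: V & (W : {set xT})].
Proof.
move=> sV ltVY; have /andP[sVY /subsetPn[t Yt Vt]] := ltVY.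
have [dis | ] := boolP [disjoint x *: V & (W : {set xT})].
  by exists x => //; apply: lcoset_refl.
case/pred0Pn=> z /andP[/= /lcosetP[v Vv ->] Wxv]; exists (x * (v * t)).
  by rewrite mem_lcoset mulKg groupM // (subsetP sVY).
rewrite disjoint_subset; apply/subsetP=> _ /lcosetP[v' Vv' ->]; rewrite !inE.
apply: contra Vt => Wxvtv.
have: t * v' \in Y :&: W.
  rewrite inE groupM ?(subsetP sVY _ Vv') //= -(groupMl _ Wxv).
  by rewrite !mulgA in Wxvtv *.
by move/(subsetP sV); rewrite groupMr.
Qed.

Lemma meet_escape Y W x (D : {set xT}) : D \subset W -> ~~ (Y \subset W) ->
  exists V : {group xT}, exists2 y, y \in x *: Y &
    [/\ V \subset Y, [disjoint y *: V & D] & prime #|Y : V|].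
Proof.
move=> sDW nsYW; have ltYW : Y :&: W \proper Y by rewrite properE subsetIl subsetI subxx.
have [V [sV sVY prV]] := abelian_prime_index_above (W := [group of Y :&: W]) ltYW.
have ltVY : V \proper Y.
  rewrite properEneq sVY andbT; apply: contraTneq prV => ->.
  by rewrite indexgg.
have [y xYy dis] := lcoset_meet_in x sV ltVY; exists V, y => //; split=> //.
by apply: disjointWr dis.
Qed.

Lemma subgroup_coset W Y x : x *: Y \subset W -> (Omega #|Y : Y :&: W| < 1)%N.
Proof.
move=> sxW; have Wx : x \in W by rewrite (subsetP sxW) ?lcoset_refl.
suff sYW : Y \subset W by rewrite (setIidPl sYW) indexgg Omega1.
by apply/subsetP=> y Yy; rewrite -(groupMl _ Wx) (subsetP sxW) // mem_lcoset mulKg.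
Qed.

Lemma subgroup_escape W Y x : ~~ (x *: Y \subset W) -> ~~ [disjoint x *: Y & (W : {set xT})] ->
  exists V : {group xT}, exists2 y, y \in x *: Y &
    [/\ V \subset Y, [disjoint y *: V & (W : {set xT})] &
        prime #|Y : V| \/ V \subset W /\ (Omega #|Y : V| <= 1)%N].
Proof.
move=> nsW /pred0Pn[z /andP[/= xYz Wz]].
have nsYW : ~~ (Y \subset W).
  apply: contra nsW => sYW; rewrite -(lcoset_eqP xYz); apply/subsetP=> _ /lcosetP[y Yy ->].
  by rewrite groupM // (subsetP sYW).
have [V [y xYy [sVY dis prV]]] := meet_escape x (subxx W) nsYW.
by exists V, y => //; split=> //; left.
Qed.

Section Difference.
Variables (M N : {group xT}) (c : nat).
Hypotheses (sNM : N \subset M) (leMN : (Omega #|M : N| <= c)%N).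

Lemma difference_stable x z : x \in M :\: N -> z \in N -> x * z \in M :\: N.
Proof. by rewrite !inE => /andP[Nx Mx] Nz; rewrite groupMr // Nx groupM // (subsetP sNM). Qed.

(** The coset lies in [M] but misses [N], so [x] is outside [N <*> Y]. Thus [N <*> Y] is proper in
    [M], and its index uses at least one of the prime factors of [#|M : N|]. *)
Lemma difference_coset Y x : x *: Y \subset M :\: N -> (Omega #|Y : Y :&: N| < c)%N.
Proof.
move=> sxD; have sxM := subset_trans sxD (subsetDl _ _).
have Mx : x \in M by rewrite (subsetP sxM) ?lcoset_refl.
have sYM : Y \subset M.
  by apply/subsetP=> y Yy; rewrite -(groupMl _ Mx) (subsetP sxM) // mem_lcoset mulKg.
have nNY : Y \subset 'N(N) by apply: subset_trans (subsetT _) (sub_abelian_norm abX (subsetT _)).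
have sJM : N <*> Y \subset M by rewrite join_subG sNM.
have ltJM : (1 < #|M : N <*> Y|)%N.
  rewrite indexg_gt1; apply/negP=> /subsetP/(_ x Mx).
  rewrite /= norm_joinEr // -(normC nNY) => /mulsgP[y z Yy Nz Dx].
  have: x * y^-1 \in M :\: N by rewrite (subsetP sxD) // mem_lcoset mulKg groupV.
  rewrite inE => /andP[/negP[]]; suff -> : x * y^-1 = z by [].
  have cyz : commute y z by apply: (centsP abX); rewrite inE.
  by rewrite Dx cyz mulgK.
apply: leq_trans leMN; rewrite (@Omega_index_trans _ M [group of N <*> Y] N) ?joing_subl //=.
suff -> : #|N <*> Y : N| = #|Y : Y :&: N| by rewrite -add1n leq_add2r Omega_gt0.
by rewrite norm_joinEr // indexMg indexgI.
Qed.

(** If [Y] is not inside [M], a coset of prime index escapes [M] itself. Otherwise the coset lies in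
    [M] and meets [N] at some [y]; then [y *: (Y :&: N)] stays in [N], and its index divides
    [#|M : N|]. *)
Lemma difference_escape Y x :
  ~~ (x *: Y \subset M :\: N) -> ~~ [disjoint x *: Y & M :\: N] ->
  exists V : {group xT}, exists2 y, y \in x *: Y &
    [/\ V \subset Y, [disjoint y *: V & M :\: N] &
        prime #|Y : V| \/ V \subset N /\ (Omega #|Y : V| <= c)%N].
Proof.
move=> nsD /pred0Pn[z /andP[/= xYz]]; rewrite inE => /andP[_ Mz].
have [sYM | nsYM] := boolP (Y \subset M); last first.
  have [V [y xYy [sVY dis prV]]] := meet_escape x (subsetDl M N) nsYM.
  by exists V, y => //; split=> //; left.
have sxM : x *: Y \subset M.
  by rewrite -(lcoset_eqP xYz); apply/subsetP=> _ /lcosetP[y Yy ->]; rewrite groupM // (subsetP sYM).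
have [y xYy Ny] : exists2 y, y \in x *: Y & y \in N.
  have [y xYy] := subsetPn nsD; rewrite inE (subsetP sxM) // andbT negbK => Ny.
  by exists y.
exists [group of Y :&: N], y => //; split; first exact: subsetIl.
  rewrite disjoint_subset; apply/subsetP=> _ /lcosetP[v /setIP[_ Nv] ->].
  by rewrite !inE groupM.
right; split; first exact: subsetIr; apply: leq_trans leMN.
rewrite /= indexgI; apply: Omega_dvd_leq; first exact: indexg_gt0.
have nNY : Y \subset 'N(N) by apply: subset_trans (subsetT _) (sub_abelian_norm abX (subsetT _)).
have sJM : N <*> Y \subset M by rewrite join_subG sNM.
by rewrite -(Lagrange_index sJM (joing_subl N Y)) /= norm_joinEr // indexMg dvdn_mull.
Qed.

End Difference.
End CosetShapes.

(** * The dual group and annihilators *)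

Section Dual.
Local Open Scope group_scope.
Variables (gT : finGroupType) (G : {group gT}).
Hypothesis abG : abelian G.

(** The dual is a finite group with a pairing, so that the covering argument, which concerns cosets
    in a group, applies to it. Characters vanish outside [G], whence the value of [e 1]; the last
    clause is column orthogonality. *)
Definition is_dual (xT : finGroupType) (e : xT -> gT -> algC) : Prop :=
  [/\ abelian [set: xT] /\ #|xT| = #|G|,
      forall g, e 1 g = (g \in G)%:R%R,
      forall u v g, (e (u * v)%g g = e u g * e v g)%R,
      forall u g h, g \in G -> h \in G -> (e u (g * h)%g = e u g * e u h)%R
    & forall g, g \in G -> g != 1 -> (\sum_u e u g = 0)%R].

(** Since [G] is abelian, all its irreducible characters are linear and their sum is the regular
    character, which vanishes off the identity. *)
Lemma dual_exists : exists (xT : finGroupType) (e : xT -> gT -> algC), is_dual e.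
Proof.
have [xT [h [injh oX linh h_onto]] [h1 hM hX _ _]] := lin_char_group G.
exists xT, (fun u => h u); split=> //.
- split; last by rewrite oX (derG1P abG) indexg1.
  by apply/centsP=> u _ v _; apply: injh; rewrite !hM mulrC.
- by move=> g; rewrite h1 cfun1E.
- by move=> u v g; rewrite hM cfunE.
- by move=> u g k Gg Gk; rewrite lin_charM.
have linG := char_abelianP _ abG.
have /fin_all_exists[k Dk] : forall i : Iirr G, exists u, ('chi_i)%R = h u.
  by move=> i; apply: h_onto.
have bijk : bijective k.
  apply: inj_card_bij; last by rewrite card_Iirr_abelian // oX (derG1P abG) indexg1.
  by move=> i j eqk; apply: irr_inj; rewrite !Dk eqk.
move=> g Gg ntg; rewrite (reindex k) /=; last exact: onW_bij.
have := cfRegE G g; rewrite (negPf ntg) mulr0n cfReg_sum sum_cfunE => regg; rewrite -[RHS]regg.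
by apply: eq_bigr => i _; rewrite cfunE lin_char1 // mul1r Dk.
Qed.

Variables (xT : finGroupType) (e : xT -> gT -> algC).
Hypothesis dual_e : is_dual e.
Implicit Types (u v : xT) (H K : {group gT}).

Lemma pair1r u : (e u 1%g = 1)%R.
Proof.
have [_ e1 eM eMr _] := dual_e.
have : (e u 1%g * e u^-1%g 1%g = 1)%R by rewrite -eM mulgV e1 group1.
have := eMr u 1 1 (group1 G) (group1 G); rewrite mulg1 => De ee1.
have nz : (e u 1%g != 0)%R by apply: contra_eq_neq ee1 => ->; rewrite mul0r eq_sym oner_neq0.
by apply: (mulfI nz); rewrite -De mulr1.
Qed.

Lemma pairX u g k : g \in G -> (e u (g ^+ k)%g = e u g ^+ k)%R.
Proof.
have [_ _ _ eMr _] := dual_e.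
move=> Gg; elim: k => [|k IHk]; first by rewrite pair1r.
by rewrite expgS eMr ?groupX // IHk exprS.
Qed.

Definition perp (A : {set gT}) : {set xT} := [set u | [forall a in G :&: A, e u a == 1%R]].

Lemma perpP (A : {set gT}) u :
  reflect (forall a, a \in G -> a \in A -> e u a = 1%R) (u \in perp A).
Proof.
rewrite inE; apply: (iffP forall_inP) => [eA a Ga Aa | eA a /setIP[Ga Aa]].
  by apply/eqP/eA; rewrite inE Ga.
by apply/eqP/eA.
Qed.

Lemma group_set_perp (A : {set gT}) : group_set (perp A).
Proof.
have [_ e1 eM _ _] := dual_e; apply/group_setP; split.
  by apply/perpP=> a Ga _; rewrite e1 Ga.
move=> u v /perpP eu /perpP ev; apply/perpP=> a Ga Aa.
by rewrite eM eu // ev // mulr1.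
Qed.
Canonical perp_group (A : {set gT}) := group (group_set_perp A).

Lemma perpS (A B : {set gT}) : A \subset B -> perp B \subset perp A.
Proof.
move=> sAB; apply/subsetP=> u /perpP eB; apply/perpP=> a Ga Aa.
by apply: eB => //; apply: (subsetP sAB).
Qed.

Lemma perp_gen (A : {set gT}) : A \subset G -> perp <<A>> = perp A.
Proof.
move=> sAG; have [_ _ _ eMr _] := dual_e; apply/eqP; rewrite eqEsubset perpS ?sub_gen //=.
apply/subsetP=> u /perpP eA.
have gK : group_set [set g in G | e u g == 1%R].
  apply/group_setP; split; first by rewrite !inE group1 pair1r eqxx.
  move=> g h; rewrite !inE => /andP[Gg /eqP eg] /andP[Gh /eqP eh].
  by rewrite groupM // eMr // eg eh mulr1 eqxx.
have sAK : <<A>> \subset group gK.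
  rewrite gen_subG; apply/subsetP=> a Aa; rewrite !inE.
  by have Ga := subsetP sAG a Aa; rewrite Ga eA // eqxx.
apply/perpP=> a _ /(subsetP sAK); rewrite !inE => /andP[_ /eqP//].
Qed.

Lemma perpU (A B : {set gT}) : perp (A :|: B) = perp A :&: perp B.
Proof.
apply/setP=> u; rewrite in_setI; apply/perpP/andP => [eAB | [/perpP eA /perpP eB] a Ga].
  by split; apply/perpP=> a Ga Aa; rewrite eAB // inE Aa ?orbT.
by rewrite inE => /orP[]; auto.
Qed.

Lemma perp_bigcup (I : finType) (P : pred I) (A : I -> {set gT}) :
  perp (\bigcup_(i | P i) A i) = \bigcap_(i | P i) perp (A i).
Proof.
elim/big_rec2: _ => [|i B C _ <-]; last exact: perpU.
by apply/setP=> u; rewrite in_setT; apply/perpP=> a _; rewrite inE.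
Qed.

Lemma sum_pair H u : H \subset G ->
  (\sum_(h in H) e u h = if u \in perp H then #|H|%:R else 0)%R.
Proof.
move=> sHG; have [_ _ _ eMr _] := dual_e.
have [/perpP eH | ] := ifPn.
  rewrite (eq_bigr (fun=> 1%R)) ?sumr_const // => h Hh.
  by rewrite eH // (subsetP sHG).
rewrite inE => /forall_inPn[h /setIP[Gh Hh] neh].
have eS : (e u h * (\sum_(k in H) e u k) = \sum_(k in H) e u k)%R.
  rewrite mulr_sumr [RHS](reindex_inj (mulgI h)) /=.
  rewrite [RHS](eq_bigl (fun k => k \in H)) => [|k]; last by rewrite groupMl.
  by apply: eq_bigr => k Hk; rewrite eMr ?(subsetP sHG k).
apply/eqP; move/eqP: eS; rewrite -subr_eq0 -{2}[(\sum_(k in H) e u k)%R]mul1r -mulrBl.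
by rewrite mulf_eq0 subr_eq0 (negPf neh).
Qed.

(** The sum of [e u h] over all [u] and all [h] in [H] is computed twice: over [h] first by
    [sum_pair], over [u] first by orthogonality. *)
Lemma card_perp H : H \subset G -> (#|perp H| * #|H|)%N = #|G|.
Proof.
move=> sHG; have [[_ oX] _ _ _ eS] := dual_e; apply/eqP; rewrite -(eqr_nat algC); apply/eqP.
transitivity (\sum_u \sum_(h in H) e u h)%R.
  rewrite (eq_bigr _ (fun u _ => sum_pair u sHG)) -big_mkcond sumr_const.
  by rewrite natrM mulr_natl.
rewrite exchange_big (bigD1 1) ?group1 //= [X in (_ + X)%R]big1 ?addr0.
  rewrite (eq_bigr (fun=> 1%R)) => [|u _]; last by rewrite pair1r.
  by rewrite sumr_const cardT -cardE -oX.
by move=> h /andP[Hh nth]; rewrite eS // (subsetP sHG).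
Qed.

Lemma index_perp K H : K \subset H -> H \subset G -> #|perp K : perp H| = #|H : K|.
Proof.
move=> sKH sHG; have sKG := subset_trans sKH sHG.
apply/eqP; rewrite -(eqn_pmul2l (cardG_gt0 [group of perp H])) /=.
rewrite -(eqn_pmul2r (cardG_gt0 K)) Lagrange ?perpS // card_perp //.
by rewrite -mulnA [(#|H : K| * _)%N]mulnC Lagrange // card_perp.
Qed.

End Dual.

(** * Hajos' theorem *)

Section Tiling.
Local Open Scope group_scope.
Variables (gT : finGroupType) (G : {group gT}) (I : finType).
Variables (a : I -> gT) (n : I -> nat).

Definition monomial (e : I -> nat) : gT := \prod_i a i ^+ e i.

Definition tiles : Prop :=
  [/\ forall i, (0 < n i)%N,
      forall i, a i \in G,
      forall e f, (forall i, e i < n i)%N -> (forall i, f i < n i)%N ->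
        monomial e = monomial f -> e =1 f
    & forall g, g \in G -> exists2 e, (forall i, e i < n i)%N & monomial e = g].

Lemma monomialD (e f : I -> nat) : (forall i j, commute (a i) (a j)) ->
  monomial (fun i => e i + f i)%N = monomial e * monomial f.
Proof.
move=> ca; rewrite /monomial; elim: (index_enum I) => [|i r IHr].
  by rewrite !big_nil mulg1.
rewrite !big_cons IHr expgD -!mulgA; congr (_ * _); rewrite !mulgA; congr (_ * _).
suff : commute (a i ^+ f i) (\prod_(j <- r) a j ^+ e j) by [].
apply: (big_ind (commute (a i ^+ f i))) => [|x y|j _]; first exact: commute1.
  exact: commuteM.
exact/commuteX/commute_sym/commuteX/commute_sym/ca.
Qed.

Definition subgen (S : {set I}) : {group gT} := [group of <<a @: S>>].

(* By unique representation the box over [S] always injects into [subgen S]; [S] is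
   tight when it fills it. *)
Definition tight (S : {set I}) : bool := #|subgen S| == (\prod_(i in S) n i)%N.

Lemma subgen_gen (S : {set I}) i : i \in S -> a i \in subgen S.
Proof. by move=> Si; rewrite mem_gen // imset_f. Qed.

Lemma subgenS (S T : {set I}) : S \subset T -> subgen S \subset subgen T.
Proof. by move=> sST; rewrite genS // imsetS. Qed.

Lemma monomial_subgen (S : {set I}) (e : I -> nat) :
  (forall i, i \notin S -> e i = 0%N) -> monomial e \in subgen S.
Proof.
move=> e0; apply: group_prod => i _; case: (boolP (i \in S)) => [Si | /e0 ->].
  by rewrite groupX // subgen_gen.
by rewrite expg0.
Qed.

Hypotheses (abG : abelian G) (tileG : tiles).

Let n_gt0 i : (0 < n i)%N. Proof. by case: tileG. Qed.
Let Ga i : a i \in G. Proof. by case: tileG. Qed.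

Let ca i j : commute (a i) (a j).
Proof. by apply: (centsP abG). Qed.

Lemma subgen_sub (S : {set I}) : subgen S \subset G.
Proof. by rewrite gen_subG; apply/subsetP=> _ /imsetP[i _ ->]. Qed.

Let N := (\sum_i n i)%N.

Let n_le i : (n i <= N.+1)%N.
Proof. by rewrite /N (bigD1 i) //= leqW // leq_addr. Qed.

(** Exponents in the box over [S], extended by 0. The common bound [N.+1] exceeds every digit, so
    boxes over different [S] share one finite type. *)
Definition box (S : {set I}) : {set {ffun I -> 'I_N.+1}} :=
  [set e in pfamily ord0 S (fun i => [pred k : 'I_N.+1 | k < n i]%N)].

Lemma boxP (S : {set I}) (e : {ffun I -> 'I_N.+1}) :
  reflect ((forall i, e i < n i)%N /\ forall i, i \notin S -> e i = 0%N :> nat) (e \in box S).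
Proof.
rewrite inE; apply: (iffP familyP) => [He | [He He0] i].
  split=> i; move: (He i) => /=; case: ifP => // Si; first by rewrite inE => /eqP->.
  by rewrite inE => /eqP->.
rewrite /=; case: ifP => Si; first exact: He.
by rewrite inE; apply/eqP/val_inj/He0; rewrite Si.
Qed.

Lemma card_box (S : {set I}) : #|box S| = (\prod_(i in S) n i)%N.
Proof.
rewrite cardsE card_pfamily foldrE big_image /=; apply: eq_bigr => i _.
by rewrite -sum1_card -(big_ord_widen _ (fun=> 1%N)) ?n_le // sum_nat_const card_ord muln1.
Qed.

Let mono (e : {ffun I -> 'I_N.+1}) := monomial (fun i => e i).

Lemma box_mono_inj (S : {set I}) : {in box S &, injective mono}.
Proof.
move=> e f /boxP[He _] /boxP[Hf _] eqm; apply/ffunP=> i; apply: val_inj.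
by have [_ _ inj _] := tileG; apply: inj eqm i.
Qed.

Lemma box_mono_sub (S : {set I}) : mono @: box S \subset subgen S.
Proof.
by apply/subsetP=> _ /imsetP[e /boxP[_ He] ->]; apply: monomial_subgen.
Qed.

Lemma leq_card_subgen (S : {set I}) : ((\prod_(i in S) n i)%N <= #|subgen S|)%N.
Proof.
by rewrite -card_box -(card_in_imset (@box_mono_inj S)) subset_leq_card ?box_mono_sub.
Qed.

Lemma tight_box (S : {set I}) : tight S -> mono @: box S = subgen S.
Proof.
move=> tS; apply/eqP; rewrite eqEcard box_mono_sub /=.
by rewrite (card_in_imset (@box_mono_inj S)) card_box -(eqP tS).
Qed.

Lemma tight_monomial (S : {set I}) g : tight S -> g \in subgen S ->
  exists e, [/\ forall i, (e i < n i)%N, forall i, i \notin S -> e i = 0%N & monomial e = g].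
Proof.
move=> tS; rewrite -(tight_box tS) => /imsetP[e /boxP[He He0] ->].
by exists (fun i => nat_of_ord (e i)).
Qed.

Lemma box_surj g : g \in G -> exists2 f, f \in box setT & mono f = g.
Proof.
move=> Gg; have [_ _ _ /(_ g Gg)[e He Dg]] := tileG.
pose f := [ffun i => inord (e i) : 'I_N.+1].
have fE i : f i = e i :> nat by rewrite ffunE inordK // (leq_trans (He i)).
exists f; last by rewrite -Dg; apply: eq_bigr => i _; rewrite fE.
by apply/boxP; split=> i; rewrite ?fE ?inE.
Qed.

Lemma tightT : tight setT.
Proof.
rewrite /tight eqn_leq leq_card_subgen andbT -card_box.
apply: leq_trans (leq_imset_card mono _); apply/subset_leq_card/subsetP=> g.
by move/(subsetP (subgen_sub _))/box_surj=> [f Bf <-]; apply: imset_f.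
Qed.

(** Every element of [G] splits uniquely into a part from the box over [Q] and a part from the box
    over its complement. The first part lies in [K], so membership in [K] depends only on the
    second, and [K] is in bijection with a product having the box over [Q] as a factor. *)
Lemma prod_dvd_card (Q : {set I}) (K : {group gT}) :
  subgen Q \subset K -> K \subset G -> (\prod_(i in Q) n i)%N %| #|K|.
Proof.
move=> sQK sKG; pose EK S := [set e in box S | mono e \in K].
have injT S : {in EK S &, injective mono}.
  by move=> e f /setIdP[He _] /setIdP[Hf _]; apply: (@box_mono_inj S).
have -> : #|K| = #|EK setT|.
  rewrite -(card_in_imset (@injT setT)); apply: eq_card => g; apply/idP/imsetP.
    move=> Kg; have [f Bf mf] := box_surj (subsetP sKG g Kg).
    by exists f => //; rewrite inE Bf mf.
  by case=> e /setIdP[_ Ke] ->.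
pose join (ef : {ffun I -> 'I_N.+1} * {ffun I -> 'I_N.+1}) :=
  [ffun i => if i \in Q then ef.1 i else ef.2 i].
suff -> : EK setT = join @: setX (box Q) (EK (~: Q)).
  rewrite card_in_imset ?cardsX ?card_box ?dvdn_mulr //.
  move=> [e f] [e' f'] /setXP[/= /boxP[_ e0] /setIdP[/boxP[_ f0] _]].
  move=> /setXP[/= /boxP[_ e0'] /setIdP[/boxP[_ f0'] _]] /ffunP eqj.
  congr (_, _); apply/ffunP=> i; have := eqj i; rewrite !ffunE /=; case: ifPn => // Qi _.
    by apply: val_inj; rewrite /= e0 // e0'.
  by apply: val_inj; rewrite /= f0 ?f0' // inE Qi.
have joinM e f : e \in box Q -> f \in box (~: Q) -> mono (join (e, f)) = mono e * mono f.
  move=> /boxP[_ e0] /boxP[_ f0]; rewrite -monomialD //; apply: eq_bigr => i _.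
  rewrite ffunE /=; case: ifPn => Qi; last by rewrite (e0 i).
  by rewrite (f0 i) ?addn0 // inE Qi.
apply/setP=> h; apply/idP/imsetP.
  case/setIdP=> /boxP[Hh _] Kh.
  pose e := [ffun i => if i \in Q then h i else ord0].
  pose f := [ffun i => if i \in ~: Q then h i else ord0].
  have Be : e \in box Q.
    apply/boxP; split=> i; rewrite ffunE; first by case: ifP.
    by move/negPf->.
  have Bf : f \in box (~: Q).
    apply/boxP; split=> i; rewrite ffunE; first by case: ifP.
    by move/negPf->.
  have Dh : h = join (e, f).
    by apply/ffunP=> i; rewrite !ffunE /= inE; case: (i \in Q).
  exists (e, f) => //; apply/setXP; split=> //; apply/setIdP; split=> //.
  move: Kh; rewrite Dh joinM // groupMl //.
  by apply: (subsetP sQK); apply: (subsetP (box_mono_sub Q)); apply: imset_f.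
case=> -[e f] /setXP[/= Be /setIdP[Bf Kf]] ->; rewrite inE joinM // groupM ?andbT //; last first.
  by apply: (subsetP sQK); apply: (subsetP (box_mono_sub Q)); apply: imset_f.
apply/boxP; split=> i; last by rewrite inE.
by rewrite ffunE /=; case: ifP => _; [case/boxP: Be | case/boxP: Bf].
Qed.

Lemma tight0 : tight set0.
Proof. by rewrite /tight /subgen /= imset0 gen0 cards1 big_set0. Qed.

(** The quotient of [subgen (i |: S)] by [subgen S] is cyclic, generated by the image of [a i],
    whose order divides [n i]; this bounds the cardinal from above. *)
Lemma tightU1 (S : {set I}) i : tight S -> i \notin S -> a i ^+ n i \in subgen S -> tight (i |: S).
Proof.
move=> tS Si anS; rewrite /tight eqn_leq leq_card_subgen andbT big_setU1 //=.
have sS : subgen S \subset subgen (i |: S) by rewrite subgenS // subsetUr.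
have abU : abelian (subgen (i |: S)) := abelianS (subgen_sub _) abG.
have nS : a i \in 'N(subgen S).
  by rewrite (subsetP (sub_abelian_norm abU sS)) // subgen_gen ?setU11.
rewrite -(Lagrange sS) (eqP tS) mulnC leq_pmul2r ?prodn_gt0 //.
rewrite -card_quotient ?(sub_abelian_norm abU) //.
have -> : subgen (i |: S) / subgen S = <[coset (subgen S) (a i)]>.
  apply/eqP; rewrite eqEsubset cycle_subG mem_quotient ?subgen_gen ?setU11 // andbT.
  rewrite quotient_gen; last first.
    apply: subset_trans (sub_abelian_norm abU sS); exact: subset_gen.
  rewrite gen_subG; apply/subsetP=> _ /morphimP[x Nx /imsetP[j Uj ->] ->] /=.
  case/setU1P: Uj => [-> | Sj]; first exact: cycle_id.
  by rewrite coset_id ?group1 // subgen_gen.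
apply: dvdn_leq => //; rewrite order_dvdn -morphX //= coset_id //.
Qed.

Variables (xT : finGroupType) (e : xT -> gT -> algC).
Hypothesis dual_e : is_dual G e.

Lemma pair_monomial u (f : I -> nat) : (e u (monomial f) = \prod_i e u (a i) ^+ f i)%R.
Proof.
have [_ _ _ eMr _] := dual_e; rewrite /monomial; elim: (index_enum I) => [|i r IHr].
  by rewrite !big_nil (pair1r dual_e).
rewrite !big_cons eMr ?groupX //; last by apply: group_prod => j _; rewrite groupX.
by rewrite IHr (pairX dual_e).
Qed.

Lemma sum_pair_tight (W : {set I}) u : tight W ->
  (\sum_(g in subgen W) e u g = \prod_(i in W) \sum_(k < n i) e u (a i) ^+ k)%R.
Proof.
move=> tW; rewrite -(tight_box tW) big_imset /=; last exact: box_mono_inj.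
under [RHS]eq_bigr => i _ do rewrite (big_ord_widen N.+1 (fun k => (e u (a i) ^+ k)%R)) //.
rewrite (big_distr_big_dep ord0) /=; apply: eq_big => [f | f /boxP[_ f0]]; first by rewrite inE.
rewrite pair_monomial (bigID (mem W)) /= [X in (_ * X)%R]big1 ?mulr1 // => i Wi.
by rewrite f0.
Qed.

(** The sum of a nontrivial character over [subgen W] vanishes and factors into geometric sums, so
    one of these vanishes. Its ratio is not 1, as the sum would then be [n i], and so it is an
    [n i]-th root of unity. *)
Lemma perp_tight (W : {set I}) u : tight W -> u \notin perp G e (subgen W) ->
  exists2 i, i \in W & (e u (a i) != 1 /\ e u (a i) ^+ n i = 1)%R.
Proof.
move=> tW /negPf nu; have := sum_pair dual_e u (subgen_sub W); rewrite nu sum_pair_tight //.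
move/eqP; case/prodf_eq0=> i Wi /eqP s0; exists i => //.
have nz : (e u (a i) != 1)%R.
  apply: contra_eq_neq s0 => ->; rewrite (eq_bigr (fun=> 1%R)) => [|k _]; last by rewrite expr1n.
  by rewrite sumr_const card_ord pnatr_eq0 -lt0n n_gt0.
by split=> //; apply/eqP; rewrite -subr_eq0 subrX1 s0 mulr0.
Qed.

(** By duality the index is that of [<[a i ^+ n i]>] in [<[a i]>], namely [gcdn #[a i] (n i)]. *)
Lemma Omega_cycle_perp i :
  (Omega #|perp G e <[a i ^+ n i]> : perp G e <[a i]>| <= Omega (n i))%N.
Proof.
rewrite (index_perp dual_e (cycleX _ _)) ?cycle_subG //; apply: Omega_dvd_leq => //.
rewrite -divgS ?cycleX // -!orderE orderXgcd.
have o0 : (0 < #[a i])%N by apply: order_gt0.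
move: #[a i] o0 => o o0; have gd := dvdn_gcdl o (n i).
have q0 : (0 < o %/ gcdn o (n i))%N
  by rewrite divn_gt0; [exact: dvdn_leq o0 gd | rewrite gcdn_gt0 o0].
have -> : (o %/ (o %/ gcdn o (n i)) = gcdn o (n i))%N.
  by apply/eqP; rewrite eq_sym eqn_div ?dvdn_div // mulnC divnK.
exact: dvdn_gcdr.
Qed.

Lemma perp_cycleP u g : g \in G -> reflect (e u g = 1%R) (u \in perp G e <[g]>).
Proof.
move=> Gg; apply: (iffP (perpP _ _ _ _)) => [-> // | eg _ _ /cycleP[k ->]]; first exact: cycle_id.
by rewrite (pairX dual_e) // eg expr1n.
Qed.

(* Hajos' theorem relative to a subset [S] whose box already fills a subgroup:
   modulo [subgen S], one of the remaining cyclic factors is a subgroup. *)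
Lemma Hajos_relative (S W : {set I}) : tight S -> tight W -> S \proper W ->
  exists2 i, i \in W :\: S & a i ^+ n i \in subgen S.
Proof.
move=> tS; have [c] := ubnP #|W :\: S|; elim: c W => // c IHc W leWc tW ltSW.
have [sSW [j Wj Sj]] : S \subset W /\ exists2 j, j \in W & j \notin S.
  by case/andP: ltSW => sSW /subsetPn.
have WSj : j \in W :\: S by rewrite inE Sj.
have [aS | naS] := boolP (a j ^+ n j \in subgen S); first by exists j.
have [[abX _] e1 _ _ _] := dual_e.
(* A character trivial on [subgen W] kills [a j ^+ n j], and so does one for which [perp_tight]
   returns [j]. Hence [D j] is the full annihilator of that element, a subgroup of weight 1; the
   other [D i] hold the characters that kill [a i ^+ n i] but not [a i]. *)
pose b i := if i == j then a j ^+ n j else a i.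
have Gb i : b i \in G by rewrite /b; case: ifP; rewrite ?groupX.
pose Nn i : {group xT} := [group of perp_group dual_e <[b i]>].
pose M i : {group xT} := [group of perp_group dual_e <[a i ^+ n i]>].
pose D i : {set xT} := if i == j then (Nn i : {set xT}) else M i :\: Nn i.
pose w i := if i == j then 1%N else Omega (n i).
pose Y : {group xT} := [group of perp_group dual_e (subgen S)].
have NM i : i != j -> Nn i \subset M i.
  by move=> neij; rewrite perpS // /b (negPf neij) cycleX.
have OM i : i != j -> (Omega #|M i : Nn i| <= Omega (n i))%N.
  by move=> neij; rewrite /= /b (negPf neij) Omega_cycle_perp.
have covY : covers D (W :\: S) (1 *: Y).
  apply/subsetP=> u; rewrite lcoset1 => Yu; apply/bigcupP.
  have [uW | /(perp_tight tW)[i Wi [nei eni]]] := boolP (u \in perp G e (subgen W)).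
    exists j => //; rewrite /D eqxx /= /b eqxx; apply/perp_cycleP; first exact: groupX.
    by move/perpP: uW; apply; rewrite ?groupX // subgen_gen.
  have Si : i \notin S.
    apply: contra nei => Si; apply/eqP; move/perpP: Yu; apply=> //; exact: subgen_gen.
  have ani : (e u (a i ^+ n i)%g = 1)%R by rewrite (pairX dual_e).
  exists i; first by rewrite inE Si.
  rewrite /D; case: eqP => [eij | /eqP neij].
    by rewrite /= /b eij eqxx; apply/perp_cycleP; rewrite ?groupX // -eij.
  rewrite inE; apply/andP; split; last by apply/perp_cycleP; rewrite ?groupX.
  by rewrite /= /b (negPf neij); apply: contra nei => /(perp_cycleP _ (Ga i))/eqP.
have [T sTWS irrT] := irredundant_exists covY.
(* The trivial character lies in none of the differences, so only [D j] can cover it. *)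
have Tj : j \in T.
  have [covT _] := irrT; have /(subsetP covT)/bigcupP[i Ti] := lcoset_refl Y 1.
  rewrite /D; case: eqP => [<- // | _]; by rewrite inE group1.
have OT : (Omega #|Y : Y :&: \bigcap_(i in T) Nn i| < \sum_(i in T) w i)%N.
  apply: Omega_irredundant_cover irrT => [i x z | i V x | i V x]; rewrite /D /w.
  - case: eqP => [_ | /eqP neij]; first exact: groupM.
    exact: difference_stable (NM i neij) _ _.
  - case: eqP => [_ | /eqP neij]; first exact: subgroup_coset.
    exact: difference_coset (NM i neij) (OM i neij) _ _.
  case: eqP => [_ | /eqP neij]; first exact: subgroup_escape.
  exact: difference_escape (NM i neij) (OM i neij) _ _.
pose B := \bigcup_(i in T) <[b i]>.
have sB : B \subset G by apply/bigcupsP=> i _; rewrite cycle_subG.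
(* By duality the covering bound becomes a bound on the index of [subgen S] in [K]; the weight 1 of
   [j] cancels against the strictness of the inequality. *)
pose K := [group of <<subgen S :|: B>>].
have sSK : subgen S \subset K by apply: subset_trans (subset_gen _); apply: subsetUl.
have sKG : K \subset G by rewrite gen_subG subUset subgen_sub.
have bK i : i \in T -> b i \in K.
  move=> Ti; rewrite mem_gen // inE; apply/orP; right.
  by apply/bigcupP; exists i; rewrite ?cycle_id.
have perpK : Y :&: \bigcap_(i in T) Nn i = perp G e K.
  by rewrite [RHS](perp_gen dual_e) ?subUset ?subgen_sub // perpU perp_bigcup.
rewrite perpK (index_perp dual_e) // (big_setD1 j) //= {1}/w eqxx add1n ltnS in OT.
set T' := T :\ j in OT.
have disST : [disjoint S & T'].
  rewrite disjoint_sym; apply/(disjointWl (subD1set _ _)).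
  by move: sTWS; rewrite subsetD => /andP[].
pose Q := S :|: T'.
have prQ : (\prod_(i in Q) n i = \prod_(i in S) n i * \prod_(i in T') n i)%N.
  by rewrite (eq_bigl [predU S & T']) ?bigU //= => i; rewrite !inE.
have sQK : subgen Q \subset K.
  rewrite gen_subG; apply/subsetP=> _ /imsetP[i Qi ->]; case/setUP: Qi => [Si | ].
    by apply: (subsetP sSK); apply: subgen_gen.
  by rewrite 2!inE => /andP[neij Ti]; have := bK i Ti; rewrite /b (negPf neij).
(* The product over [Q] divides [#|K|] and has at least as many prime factors, so they are equal.
   Hence [Q] is tight with [subgen Q = K], and it can replace [W] in the induction because it omits
   [j]. *)
have cardK : (\prod_(i in Q) n i)%N = #|K|.
  apply: Omega_dvd_eq; [exact: cardG_gt0 | exact: prod_dvd_card |].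
  rewrite -(Lagrange sSK) prQ (eqP tS) !OmegaM ?indexg_gt0 ?prodn_gt0 // leq_add2l.
  apply: leq_trans OT _; rewrite Omega_prod //; apply: eq_leq; apply: eq_bigr => i.
  by rewrite /w 2!inE => /andP[/negPf->].
have tQ : tight Q by rewrite /tight eqn_leq leq_card_subgen andbT cardK subset_leq_card.
have eKQ : subgen Q = K :> {set gT}.
  by apply/eqP; rewrite eqEcard sQK (eqP tQ) cardK leqnn.
have T'0 : T' != set0.
  apply: contraNneq naS => T0; have := bK j Tj.
  by rewrite -eKQ /Q T0 setU0 /b eqxx.
have sT'W : T' \subset W :\: S := subset_trans (subD1set _ _) sTWS.
have QS : Q :\: S = T'.
  by rewrite /Q setDUl setDv set0U; apply/setDidPl; rewrite disjoint_sym.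
have [||i] := IHc Q _ tQ.
- rewrite QS -ltnS; apply: leq_trans leWc; rewrite ltnS proper_card // properE sT'W.
  by apply/subsetPn; exists j => //; rewrite !inE eqxx.
- rewrite properE subsetUl /=; have /set0Pn[i T'i] := T'0; apply/subsetPn; exists i.
    by rewrite inE T'i orbT.
  by rewrite (disjointFl disST).
by rewrite QS => T'i ai; exists i => //; apply: (subsetP sT'W).
Qed.

End Tiling.

(** From the empty prefix on, [Hajos_relative] within the full index set supplies the next index and
    [tightU1] keeps the longer prefix tight. *)
Lemma tight_chain (gT : finGroupType) (G : {group gT}) (I : finType)
    (a : I -> gT) (n : I -> nat) : abelian G -> tiles G a n ->
  exists s : seq I, [/\ uniq s, forall i, i \in s & forall k, tight a n [set i in take k s]].
Proof.
move=> abG tG; have [xT [e dual_e]] := dual_exists abG.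
suff [s [us ss ts]] : exists s : seq I, [/\ uniq s, size s = #|I| &
    forall k, tight a n [set i in take k s]].
  exists s; split=> // i; have sse : {subset s <= enum I} by move=> k _; rewrite mem_enum.
  by have [|_ ->] := uniq_min_size us sse; rewrite ?mem_enum // -cardE ss.
have : (#|I| <= #|I|)%N by []. 
elim: {-2}#|I| => [_ | c IHc ltc].
  by exists [::]; split=> // k; rewrite (_ : [set i in _] = set0) ?tight0 //; apply/setP=> i; rewrite !inE.
have [s [us ss ts]] := IHc (ltnW ltc).
pose S := [set i in s].
have tS : tight a n S by have := ts (size s); rewrite take_size.
have cS : #|S| = c by rewrite cardsE (card_uniqP us).
have ltST : S \proper [set: I] by rewrite properEcard subsetT cardsT cS.
have [i] := Hajos_relative abG tG dual_e tS (tightT tG) ltST.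
rewrite !inE andbT => si ai; exists (rcons s i); split.
- by rewrite rcons_uniq si.
- by rewrite size_rcons ss.
move=> k; have [lek | ltk] := leqP k (size s).
  by rewrite -cats1 takel_cat.
rewrite take_oversize ?size_rcons //.
have -> : [set x in rcons s i] = i |: S by apply/setP=> x; rewrite !inE mem_rcons inE.
by apply: (tightU1 abG tG) => //; rewrite inE.
Qed.

(** * Leading exponents and the rank *)

Section LexKey.
Variables (I : eqType) (B : nat).

(* [lexkey v s] lists the digits [v i] in base [B], least significant first, so
   that comparing keys is comparing [v] lexicographically from the end of [s]. *)
Definition lexkey (v : I -> nat) (s : seq I) : nat :=
  foldr (fun i acc => v i + B * acc) 0 s.

Lemma lexkey_inj (v u : I -> nat) (s : seq I) :
  (forall i, v i < B) -> (forall i, u i < B) ->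
  lexkey v s = lexkey u s -> {in s, v =1 u}.
Proof.
move=> vB uB; elim: s => //= i s IHs eqk.
have B0 : 0 < B by apply: leq_ltn_trans (vB i).
have eq1 : v i = u i.
  by have := congr1 (modn^~ B) eqk; rewrite ![_ + B * _]addnC ![B * _]mulnC !modnMDl !modn_small.
move/eqP: eqk; rewrite eq1 eqn_add2l eqn_pmul2l // => /eqP/IHs eqs j.
by rewrite inE => /predU1P[->|/eqs].
Qed.

(** The tail of [s] carries the higher digits, so it decides first and the head matters only on a
    tie. *)
Lemma lexkey_lt (v u : I -> nat) (s : seq I) : uniq s ->
  (forall i, v i < B) -> (forall i, u i < B) -> lexkey v s < lexkey u s ->
  exists k, [/\ k \in s, v k < u k & {in s, forall i, index k s < index i s -> v i = u i}].
Proof.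
move=> + vB uB; elim: s => //= i s IHs /andP[si us] ltk.
have [ltvu | ltuv | eqvu] := ltngtP (lexkey v s) (lexkey u s).
- have [k [sk ltk' eqk]] := IHs us ltvu; exists k; split=> //.
    by rewrite inE sk orbT.
  have /negPf-> : i != k by apply: contraNneq si => ->.
  move=> j; rewrite inE => /predU1P[-> | sj]; first by rewrite eqxx.
  have /negPf-> : i != j by apply: contraNneq si => ->.
  exact: eqk.
- suff : lexkey u (i :: s) < lexkey v (i :: s) by rewrite /= ltnNge (ltnW ltk).
  rewrite /=; apply: leq_trans (leq_addl _ _); apply: leq_trans (leq_mul (leqnn B) ltuv).
  by rewrite mulnS ltn_add2r.
exists i; split; first exact: mem_head; first by move: ltk; rewrite eqvu ltn_add2r.
by move=> j; rewrite inE => /predU1P[->|/(lexkey_inj vB uB eqvu)//]; rewrite eqxx.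
Qed.

End LexKey.

Section LexMonomial.
Local Open Scope group_scope.
Variables (gT : finGroupType) (G : {group gT}) (I : finType).
Variables (a : I -> gT) (n : I -> nat) (s : seq I).
Hypotheses (abG : abelian G) (tileG : tiles G a n).
Hypothesis s_full : forall i, i \in s.
Hypothesis s_tight : forall k, tight a n [set i in take k s].

Let ca i j : commute (a i) (a j).
Proof. by apply: (centsP abG); case: tileG. Qed.

(** The exponent [f] may leave the box before [k]. That prefix is tight, so its part of the monomial
    can be rewritten inside the box over the same prefix, without disturbing the exponent at [k];
    unique representation would then force [f k = v k]. *)
Lemma monomial_lex_neq (f v : I -> nat) k :
  (forall i, v i < n i)%N -> (f k < v k)%N ->
  (forall i, index k s < index i s -> f i = v i)%N -> monomial a f <> monomial a v.
Proof.
move=> vn fk fv eqm; pose S := [set i in take (index k s) s].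
have inS i : (i \in S) = (index i s < index k s)%N by rewrite inE in_take.
pose lo i := if i \in S then f i else 0%N.
pose hi i := if i \in S then 0%N else f i.
have Df : monomial a f = monomial a lo * monomial a hi.
  rewrite -monomialD //; apply: eq_bigr => i _; congr (_ ^+ _).
  by rewrite /lo /hi; case: ifP; rewrite ?addn0.
have [|w [wn w0 Dw]] := tight_monomial tileG (s_tight (index k s)) (g := monomial a lo).
  by apply: monomial_subgen => i; rewrite /lo => /negPf->.
have [_ _ inj _] := tileG.
have := inj (fun i => w i + hi i)%N v _ vn; rewrite monomialD // Dw -Df => /(_ _ eqm) eqw.
have : (w k + hi k = v k)%N.
  apply: eqw => i; rewrite /hi; case: ifPn => [_ | Si]; first by rewrite addn0.
  rewrite w0 // add0n; move: Si; rewrite inS -leqNgt leq_eqVlt => /orP[/eqP eqk | ltk].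
    have -> : i = k by exact: (index_inj i (s_full i) (s_full k) (esym eqk)).
    exact: ltn_trans fk _.
  by rewrite fv.
by rewrite w0 ?inS ?ltnn // /hi inS ltnn add0n => eqk; rewrite eqk ltnn in fk.
Qed.

End LexMonomial.

(** * Independence of automorphisms and the rank *)

Section Rank.
Local Open Scope ring_scope.
Variables (F : fieldType) (L : splittingFieldType F).
Implicit Types (P : {ffun gal_of {:L} -> L}) (g : gal_of {:L}).

Lemma actL_linear P : linear (actL P).
Proof.
move=> c x y; rewrite /actL scaler_sumr -big_split; apply: eq_bigr => g _ /=.
by rewrite linearP mulrDr scalerAr.
Qed.

HB.instance Definition _ P := GRing.isLinear.Build F L L *:%R (actL P) (actL_linear P).

(** Products of automorphisms act from left to right, so [g] after [h] is [h * g], and the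
    coefficient at [h] comes from [h * g^-1]. *)
Lemma actL_comp P g x : g \in ('Gal({:L} / 1%AS))%g ->
  g (actL P x) = \sum_(h in ('Gal({:L} / 1%AS))%g) g (P (h * g^-1)%g) * h x.
Proof.
move=> Gg; rewrite /actL rmorph_sum /= [RHS](reindex_inj (mulIg g)) /=.
rewrite [RHS](eq_bigl (fun h => h \in ('Gal({:L} / 1%AS))%g)) => [|h]; last by rewrite groupMr.
by apply: eq_bigr => h _; rewrite rmorphM /= mulgK galM ?memvf.
Qed.

(* If the elements of [V] outnumber the rank, some nontrivial [L]-combination of
   their compositions with [P] vanishes identically; by Dedekind's independence
   of automorphisms all its coefficients vanish. *)
Lemma rank_relation P (T : finType) (V : {set T}) (sg : T -> gal_of {:L}) :
  (forall v, sg v \in ('Gal({:L} / 1%AS))%g) -> (rkK P < #|V|)%N ->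
  exists2 c : T -> L, exists2 v, v \in V & c v != 0 &
    forall h, h \in ('Gal({:L} / 1%AS))%g ->
      \sum_(v in V) c v * sg v (P (h * (sg v)^-1)%g) = 0.
Proof.
move=> Gsg ltr; set W := limg (linfun (actL P)).
(* Each row holds the values of one [sg v] on a basis of the image. There are more rows than
   columns, so some nonzero row vector kills [M]. *)
pose M : 'M[L]_(#|V|, \dim W) := \matrix_(i, k) sg (enum_val i) (vbasis W)`_k.
have /rowV0Pn[c cM c0] : kermx M != 0.
  rewrite kermx_eq0; apply: contraL ltr => /eqP rM; rewrite -leqNgt -{1}rM.
  exact: rank_leq_col.
have /sub_kermxP{}cM := cM.
have [i0 ci0] : exists i, c 0 i != 0.
  apply/existsP; apply: contraR c0; rewrite negb_exists => /forallP ci.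
  by apply/eqP/rowP=> i; rewrite mxE; apply/eqP; rewrite -[_ == _]negbK.
pose d v := \sum_(i < #|V| | enum_val i == v) c 0 i.
have dE i : d (enum_val i) = c 0 i.
  by rewrite /d (big_pred1 i) // => k; rewrite (inj_eq enum_val_inj).
exists d; first by exists (enum_val i0); [apply: enum_valP | rewrite dE].
have sumV (f : T -> L) : \sum_(v in V) d v * f v = \sum_(i < #|V|) c 0 i * f (enum_val i).
  by rewrite big_enum_val /=; apply: eq_bigr => i _; rewrite dE.
apply: (@gal_independent _ _ _ [in ('Gal({:L} / 1%AS))%g]) => x _.
transitivity (\sum_(v in V) d v * sg v (actL P x)).
  under [RHS]eq_bigr => v _ do rewrite actL_comp // mulr_sumr.
  rewrite exchange_big /=; apply: eq_bigr => h _; rewrite mulr_suml.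
  by apply: eq_bigr => v _; rewrite mulrA.
have Wx : actL P x \in W by rewrite -lfunE memv_img ?memvf.
rewrite sumV (coord_vbasis Wx).
under eq_bigr => i _ do rewrite linear_sum mulr_sumr.
rewrite exchange_big big1 //= => k _.
under eq_bigr => i _ do rewrite linearZ /= -scalerAr.
rewrite -scaler_sumr; have := congr1 (fun A : 'M[L]__ => A 0 k) cM; rewrite !mxE.
under eq_bigr => i _ do rewrite mxE.
by move=> ->; rewrite scaler0.
Qed.

End Rank.

Lemma addn_subn_ltn (z x u v : nat) :
  u <= x -> z <= u -> x <= v -> (z < u) || (x < v) -> z + (x - u) < v.
Proof. by move=> ux zu xv /orP[] ?; lia. Qed.

Section RankBound.
Local Open Scope ring_scope.
Variables (F : fieldType) (L : splittingFieldType F) (m : nat) (n : 'I_m -> nat).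
Variables (th : 'I_m -> gal_of {:L}) (P : {ffun gal_of {:L} -> L}).
Let G := ('Gal({:L} / 1%AS))%G.
Hypotheses (n_gt0 : forall j, (0 < n j)%N) (Gth : forall j, th j \in G).
Hypothesis cth : forall j k, (th j * th k = th k * th j)%g.
Hypothesis th_inj : injective (thetaPow th : Delta n -> gal_of {:L}).
Hypothesis th_surj : forall g, g \in G -> exists i : Delta n, thetaPow th i = g.
Hypothesis P_neq0 : exists2 g, g \in G & P g != 0.

Let expo (i : Delta n) (j : 'I_m) : nat := i j.

Let thetaE (i : Delta n) : thetaPow th i = monomial th (expo i).
Proof. by []. Qed.

Lemma Delta_fun (e : 'I_m -> nat) : (forall j, e j < n j)%N ->
  exists i : Delta n, forall j, i j = e j :> nat.
Proof. by move=> He; exists [ffun j => Ordinal (He j)] => j; rewrite ffunE. Qed.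

Lemma theta_tiles : tiles G th n.
Proof.
split=> // [e f He Hf eqm | g Gg].
  have [[i Hi] [k Hk]] := (Delta_fun He, Delta_fun Hf).
  have eik : i = k.
    apply: th_inj; rewrite !thetaE.
    have -> : monomial th (expo i) = monomial th e.
      by apply: eq_bigr => j _; rewrite /expo Hi.
    by rewrite eqm; apply: eq_bigr => j _; rewrite /expo Hk.
  by move=> j; rewrite -Hi -Hk eik.
by have [i <-] := th_surj Gg; exists (expo i) => // j; apply: ltn_ord.
Qed.

Lemma theta_abelian : abelian G.
Proof.
apply/centsP=> g Gg h Gh; have [[i <-] [k <-]] := (th_surj Gg, th_surj Gh).
rewrite /commute !thetaE -!monomialD //.
by apply: eq_bigr => j _; rewrite addnC.
Qed.

Lemma card_Delta_ge (u : Delta n) :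
  #|[set v : Delta n | [forall j, u j <= v j]%N]| = (\prod_j (n j - u j))%N.
Proof.
transitivity #|(family (fun j => [pred k : 'I_(n j) | u j <= k]%N) : simpl_pred (Delta n))|.
  rewrite cardsE; apply: eq_card => v; rewrite [LHS]inE; apply/forallP/familyP => H j.
    by rewrite inE.
  by have := H j; rewrite inE.
rewrite card_family foldrE big_map big_enum /=; apply: eq_bigr => j _.
rewrite -sum1_card big_mkcond /= -(big_mkord xpredT (fun k => if (u j <= k)%N then 1%N else 0%N)).
rewrite -big_mkcond /= (big_cat_nat _ (n := u j)) ?(ltnW (ltn_ord _)) //=.
rewrite big_nat_cond big1 => [|k /andP[/andP[_ ltk]]]; last by rewrite leqNgt ltk.
rewrite add0n big_nat_cond (eq_bigl (fun k => u j <= k < n j)%N) => [|k].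
  by rewrite -big_nat sum_nat_const_nat muln1.
by case: (u j <= k)%N; rewrite ?andbT ?andbF.
Qed.

Lemma rank_bound : exists2 u : Delta n, P (thetaPow th u) != 0 &
  (\prod_j (n j - u j) <= rkK P)%N.
Proof.
have tG := theta_tiles; have abG := theta_abelian.
have [s [us fs ts]] := tight_chain abG tG.
pose B := (\sum_j n j)%N.
have ltB (i : Delta n) j : (expo i j < B)%N.
  by apply: leq_trans (ltn_ord (i j)) _; rewrite /B (bigD1 j) //= leq_addr.
pose key (i : Delta n) := lexkey B (expo i) s.
have key_inj i k : key i = key k -> i = k.
  move=> eqk; apply/ffunP=> j; apply: val_inj.
  exact: (lexkey_inj (ltB i) (ltB k) eqk (fs j)).
have [g Gg Pg] := P_neq0; have [i0 Di0] := th_surj Gg.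
have Pi0 : P (thetaPow th i0) != 0 by rewrite Di0.
case: (@arg_maxnP _ i0 (fun i => P (thetaPow th i) != 0) key Pi0) => u Pu maxu.
exists u => //; rewrite leqNgt -card_Delta_ge; apply/negP=> ltr.
pose df (v : Delta n) j := (v j - u j)%N.
pose sg v := monomial th (df v).
have Gm e : monomial th e \in G by apply: group_prod => j _; rewrite groupX.
have [c [v1 Vv1 cv1] sum0] := rank_relation (fun v => Gm (df v)) ltr.
(* With [v] of largest key among the exponents having [c v != 0], the relation is read at
   [thetaPow th v]. The term of [v] is [c v] times the image of the leading coefficient of [P],
   hence nonzero; the other terms are shown to vanish. *)
case: (@arg_maxnP _ v1 (fun v => (v \in [set v : Delta n | [forall j, u j <= v j]%N]) && (c v != 0)) key).
  by rewrite Vv1 cv1.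
move=> v /andP[Vv cv] maxv.
have := sum0 (thetaPow th v) (Gm _).
have geu (x : Delta n) : x \in [set v : Delta n | [forall j, u j <= v j]%N] ->
    forall j, (u j <= x j)%N by rewrite inE => /forallP.
rewrite (bigD1 v) //= big1 ?addr0 => [/eqP | x /andP[Vx nexv]].
  have -> : (thetaPow th v * (monomial th (df v))^-1)%g = thetaPow th u.
    apply: (canLR (mulgK _)); rewrite !thetaE -monomialD //.
    by apply: eq_bigr => j _; rewrite /df /expo subnKC ?(geu v).
  by rewrite mulf_eq0 (negPf cv) fmorph_eq0 (negPf Pu).
have [-> | cx] := eqVneq (c x) 0; first by rewrite mul0r.
set h := (_ * _)%g; have Gh : h \in G by rewrite groupM ?groupV ?Gm.
have [z Dz] := th_surj Gh.
have [-> | Ph] := eqVneq (P h) 0; first by rewrite rmorph0 mulr0.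
(* A nonzero term for [x] yields an exponent [z] of [P] such that [z + (x - u)] and [v] give the
   same automorphism. The sum may leave the box, so the contradiction comes from [monomial_lex_neq]
   rather than directly from unique representation. *)
have Dm : monomial th (fun j => z j + df x j)%N = monomial th (expo v).
  by rewrite monomialD // -[X in (X * _)%g]thetaE Dz mulgKV.
have ltxv : (key x < key v)%N.
  rewrite ltn_neqAle; apply/andP; split; first by apply: contra nexv => /eqP/key_inj->.
  by apply: maxv; rewrite Vx.
have lezu : (key z <= key u)%N by apply: maxu; rewrite Dz.
have vn j : (expo v j < n j)%N by apply: ltn_ord.
have [k1 [_ ltk1 eqk1]] := lexkey_lt us (ltB x) (ltB v) ltxv.
have neq := monomial_lex_neq abG tG fs ts vn _ _ Dm.
have [ezu | nezu] := eqVneq z u.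
  case: (neq k1) => [|j ltj]; rewrite /df ezu subnKC ?(geu x) //.
  exact: eqk1.
have ltzu : (key z < key u)%N by rewrite ltn_neqAle lezu andbT; apply: contra nezu => /eqP/key_inj->.
have [k2 [_ ltk2 eqk2]] := lexkey_lt us (ltB z) (ltB u) ltzu.
have gx j := geu x Vx j.
have eqfv j : z j = u j :> nat -> x j = v j :> nat -> (z j + df x j = v j)%N.
  by rewrite /df => -> <-; rewrite subnKC.
(* At whichever of [k1] and [k2] comes later in [s], [z + (x - u)] is below [v]; beyond it [z]
   agrees with [u] and [x] with [v], so the two exponents coincide. *)
have [lt12 | lt21 | eq12] := ltngtP (index k1 s) (index k2 s).
- case: (neq k2) => [|j ltj]; last by apply: eqfv; [exact: eqk2 | apply: eqk1 (ltn_trans lt12 ltj)].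
  by apply: addn_subn_ltn; rewrite ?gx ?ltk2 ?(eqk1 k2 (fs k2) lt12 : x k2 = v k2 :> nat) // ltnW.
- case: (neq k1) => [|j ltj]; last by apply: eqfv; [apply: eqk2 (ltn_trans lt21 ltj) | exact: eqk1].
  by apply: addn_subn_ltn; rewrite ?gx ?ltk1 ?orbT ?(eqk2 k1 (fs k1) lt21 : z k1 = u k1 :> nat) // ltnW.
have ek : k1 = k2 := index_inj k1 (fs k1) (fs k2) eq12; rewrite -{}ek in ltk2 eqk2.
case: (neq k1) => [|j ltj]; last by apply: eqfv; [exact: eqk2 | exact: eqk1].
by apply: addn_subn_ltn; rewrite ?gx ?ltk1 ?orbT // ltnW.
Qed.
End RankBound.

(** * The minimum of the products *)

Section Greedy.
Implicit Types (ys ks : seq nat).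

Lemma sum_ltn_prodS ys : \sum_(y <- ys) y < \prod_(y <- ys) y.+1.
Proof. by elim: ys => [|y ys IHys]; rewrite ?big_nil // !big_cons; nia. Qed.

(* Moving units one factor at a time onto [y0] until it reaches its maximum [k]
   never increases the product. *)
Lemma gather_prodS k ys y0 : y0 <= k -> all (leq^~ k) ys -> k <= y0 + \sum_(y <- ys) y ->
  exists zs, [/\ all2 leq zs ys, k + \sum_(z <- zs) z = y0 + \sum_(y <- ys) y
    & k.+1 * \prod_(z <- zs) z.+1 <= y0.+1 * \prod_(y <- ys) y.+1].
Proof.
elim: ys y0 => [|y ys IHys] y0 le0 /=.
  by rewrite big_nil addn0 => _ le1; exists [::]; split; rewrite ?big_nil //; lia.
case/andP=> ley allys; rewrite !big_cons => lek; have [lt0 | ge0] := ltnP (y0 + y) k.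
  have [||zs [zy sz pz]] := IHys (y0 + y) _ allys; [lia | lia |].
  exists (0 :: zs); rewrite /= !big_cons zy; split=> //; first by lia.
  rewrite mul1n; apply: leq_trans pz _; rewrite mulnA leq_mul2r; nia.
exists ((y0 + y - k) :: ys); rewrite /= !big_cons; split; last 1 first.
- rewrite !mulnA leq_mul2r; apply/orP; right.
  have -> : (y0 + y - k).+1 = y0 + y.+1 - k by lia.
  (* Here [t] is the amount moved onto [y0] and [r] what remains of [y]. Since [y <= k] gives
     [r <= y0], [(y0 + t + 1)(r + 1) <= (y0 + 1)(t + r + 1)]. *)
  have [t Dt] : exists t, k = y0 + t by exists (k - y0); lia.
  have [r Dr] : exists r, y = t + r by exists (y - t); lia.
  have -> : y0 + y.+1 - k = r.+1 by lia.
  nia.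
- by apply/andP; split; [lia | elim: (ys) => //= z zs ->; rewrite leqnn].
lia.
Qed.

(** Packing the total into the largest caps, which come first, minimizes the product. [gather_prodS]
    fills the first cap, which bounds all entries because [ks] is nonincreasing, and induction
    treats the rest; [sum_ltn_prodS] settles [s = 0]. *)
Lemma greedy_prodS ks ys s c : sorted geq ks -> all2 leq ys ks -> s < size ks ->
  c <= nth 0 ks s -> \sum_(y <- ys) y = \sum_(k <- take s ks) k + c ->
  (\prod_(k <- take s ks) k.+1) * c.+1 <= \prod_(y <- ys) y.+1.
Proof.
elim: ks ys s => // k ks IHks [|y ys] // [|s] /= sk /andP[ley leys] lts lec.
  by rewrite !big_nil mul1n => eqc; rewrite -[c]add0n -eqc sum_ltn_prodS.
rewrite !big_cons => eqs.
have sks : sorted geq ks by apply: path_sorted sk.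
have geq_trans : transitive geq by move=> a b d; rewrite /geq /= => ? ?; lia.
have allk : all (leq^~ k) ks by have := order_path_min geq_trans sk.
have ally : all (leq^~ k) ys.
  elim: ys ks leys allk {IHks eqs sk lts lec sks} => [|z ys IH] [|k' ks] //= /andP[lez leys] /andP[lek' allk].
  by rewrite (leq_trans lez) // (IH ks).
have [|zs [zy sz pz]] := gather_prodS ley ally; first by lia.
apply: leq_trans pz; rewrite -mulnA leq_mul2l /=; apply: IHks => //; last by lia.
by move: zy leys {eqs allk ally sz sk sks lts lec}; elim: zs ys ks => [|z zs IH] [|y' ys] [|k' ks] //= /andP[? zy] /andP[? yk];
  rewrite (IH ys) // andbT; lia.
Qed.

End Greedy.

Lemma bigminn_leq (T : finType) (A : pred T) (f : T -> nat) x0 u :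
  A u -> \big[minn/x0]_(v | A v) f v <= f u.
Proof.
move=> Au; have : u \in index_enum T by rewrite mem_index_enum.
elim: (index_enum T) => // v r IHr; rewrite inE big_cons => /predU1P[<- | /IHr le].
  by rewrite Au geq_minl.
by case: ifP => // _; rewrite geq_min le orbT.
Qed.

Lemma leq_bigminn (T : finType) (A : pred T) (f : T -> nat) x0 c :
  c <= x0 -> (forall u, A u -> c <= f u) -> c <= \big[minn/x0]_(v | A v) f v.
Proof.
move=> c0 cf; apply: (big_ind (leq c)) => // x y cx cy; by rewrite leq_min cx.
Qed.

(** * The minimum over exponents of given total *)

Section MinProd.
Variables (m : nat) (n : 'I_m -> nat).

(** As long as the total of [u] is the smaller one, some [u j < i j] can be raised by one inside
    [Delta n], which does not increase the product. *)
Lemma absidx_raise (u i : Delta n) : absidx u <= absidx i ->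
  exists2 v : Delta n, absidx v = absidx i & \prod_j (n j - v j) <= \prod_j (n j - u j).
Proof.
have [c] := ubnP (absidx i - absidx u); elim: c u => // c IHc u ltc leui.
have [eui | neui] := eqVneq (absidx u) (absidx i); first by exists u.
have ltui : absidx u < absidx i by rewrite ltn_neqAle neui.
have [j ltj] : exists j, u j < i j.
  apply/existsP; apply: contraLR ltui; rewrite negb_exists => /forallP H.
  by rewrite -leqNgt; apply: leq_sum => j _; rewrite leqNgt.
have ltn j' : (u j' + (j' == j) < n j').
  case: eqP => [-> | _]; last by rewrite addn0.
  by rewrite addn1; apply: leq_ltn_trans ltj _.
pose w : Delta n := [ffun j' => Ordinal (ltn j')].
have wE j' : w j' = u j' + (j' == j) :> nat by rewrite ffunE.
have aw : absidx w = (absidx u).+1.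
  rewrite /absidx (eq_bigr _ (fun j' _ => wE j')) big_split /= -[RHS]addn1; congr (_ + _).
  by rewrite (bigD1 j) //= eqxx big1 // => k /negPf->.
have [||v av pv] := IHc w; rewrite ?aw //.
  by rewrite subnS -ltnS prednK // subn_gt0.
exists v => //; apply: leq_trans pv _; apply: leq_prod => k _; by rewrite wE leq_sub2l // leq_addr.
Qed.

(** This is needed because a lexicographically leading exponent of [P] may have a total below the
    degree. *)
Lemma minProd_leq (u i : Delta n) : absidx u <= absidx i ->
  minProd n (absidx i) <= \prod_j (n j - u j).
Proof.
move=> /absidx_raise[v av pv]; apply: leq_trans pv.
by apply: bigminn_leq; rewrite av.
Qed.

Lemma prod_split_at (F : 'I_m -> nat) (s : 'I_m) :
  \prod_j F j = (\prod_(j < m | j < s) F j) * F s * \prod_(j < m | s < j) F j.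
Proof.
rewrite (bigID (fun j : 'I_m => j < s)) /= -mulnA; congr (_ * _).
rewrite (bigD1 s) ?ltnn //=; congr (_ * _); apply: eq_bigl => j.
by rewrite -leqNgt ltn_neqAle andbC eq_sym.
Qed.

Lemma sum_split_at (F : 'I_m -> nat) (s : 'I_m) :
  \sum_j F j = (\sum_(j < m | j < s) F j) + F s + \sum_(j < m | s < j) F j.
Proof.
rewrite (bigID (fun j : 'I_m => j < s)) /= -addnA; congr (_ + _).
rewrite (bigD1 s) ?ltnn //=; congr (_ + _); apply: eq_bigl => j.
by rewrite -leqNgt ltn_neqAle andbC eq_sym.
Qed.

Lemma take_enum_ord (s : 'I_m) : take s (enum 'I_m) = [seq j : 'I_m <- enum 'I_m | j < s].
Proof.
apply: (inj_map val_inj); rewrite map_take val_enum_ord take_iota.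
rewrite (minn_idPl (ltnW (ltn_ord s))) -(filter_map val (fun k => k < s)) val_enum_ord.
by rewrite -[in RHS](add0n (s : nat)) filter_iota_ltn // ltnW.
Qed.

Hypothesis n_gt0 : forall j, 0 < n j.
Hypothesis n_dec : forall j k : 'I_m, j <= k -> n k <= n j.

(** The minimum is attained by saturating the coordinates after [s], where the [n j] are smallest,
    and putting [l] at [s]. *)
Lemma minProd_eq (s : 'I_m) l : l < n s ->
  minProd n (\sum_(j < m | s < j) (n j - 1) + l) = (n s - l) * \prod_(j < m | j < s) n j.
Proof.
move=> ltl; set d := (_ + l); apply/eqP; rewrite eqn_leq; apply/andP; split.
  have ltu (j : 'I_m) : (if j < s then 0 else if s < j then n j - 1 else l) < n j.
    case: (ltngtP j s) => [_ | _ | eqj] //; first by rewrite subn1 ltn_predL.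
    by have -> : j = s by apply: ord_inj.
  pose u : Delta n := [ffun j => Ordinal (ltu j)].
  have uE j : u j = (if j < s then 0 else if s < j then n j - 1 else l) :> nat by rewrite ffunE.
  have au : absidx u == d.
    rewrite /absidx (sum_split_at _ s) big1 => [|j ltj]; last by rewrite uE ltj.
    rewrite uE ltnn add0n addnC /d eqn_add2r; apply/eqP; apply: eq_bigr => j ltj.
    by rewrite uE ltj ltnNge (ltnW ltj).
  apply: leq_trans (bigminn_leq _ _ au) _; rewrite (prod_split_at _ s).
  rewrite [X in _ * X]big1 => [|j ltj]; last first.
    by rewrite uE ltj ltnNge (ltnW ltj) /= subKn.
  rewrite muln1 uE ltnn mulnC leq_mul2l; apply/orP; right; apply: leq_prod => j ltj.
  by rewrite uE ltj subn0.
apply: leq_bigminn.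
  (* The default value of the minimum, the full product, also has to satisfy the lower bound. *)
  rewrite (prod_split_at _ s) mulnC -mulnA leq_mul2l; apply/orP; right.
  apply: leq_trans (leq_subr _ _) _; apply: leq_pmulr; rewrite prodn_gt0 //.
(* In the complementary variables [y j = n j - 1 - u j] with caps [k j = n j - 1], the factors are
   [y j + 1], and their total fills the caps before [s] and leaves [k s - l], as in
   [greedy_prodS]. *)
move=> u /eqP au; pose y j := (n j - u j).-1; pose k j := (n j).-1.
have yk j : k j = y j + u j by rewrite /k /y; have := ltn_ord (u j); lia.
have prodk : \prod_(j <- take s [seq k j | j <- enum 'I_m]) j.+1 = \prod_(j < m | j < s) n j.
  rewrite -map_take big_map take_enum_ord big_filter big_enum_cond /=.
  by apply: eq_bigr => j _; rewrite prednK.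
have sumk : \sum_(j <- take s [seq k j | j <- enum 'I_m]) j = \sum_(j < m | j < s) k j.
  by rewrite -map_take big_map take_enum_ord big_filter big_enum_cond.
have -> : \prod_j (n j - u j) = \prod_(x <- [seq y j | j <- enum 'I_m]) x.+1.
  rewrite big_map big_enum; apply: eq_bigr => j _; rewrite /y prednK // subn_gt0; exact: ltn_ord.
have -> : n s - l = (k s - l).+1 by rewrite /k; lia.
rewrite mulnC -prodk; apply: greedy_prodS.
- rewrite sorted_map; have : sorted (relpre val ltn) (enum 'I_m).
    by rewrite -sorted_map val_enum_ord iota_ltn_sorted.
  by apply: sub_sorted => i j /= /ltnW/n_dec ?; rewrite /k -!subn1 leq_sub2r.
- by elim: (enum 'I_m) => //= j r ->; rewrite andbT yk leq_addr.
- by rewrite size_map size_enum_ord.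
- by rewrite (nth_map s) ?size_enum_ord // nth_ord_enum leq_subr.
rewrite sumk; have -> : \sum_(x <- [seq y j | j <- enum 'I_m]) x = \sum_j y j.
  by rewrite big_map big_enum.
have sumy : \sum_j k j = \sum_j y j + d.
  by rewrite -au -big_split; apply: eq_bigr => j _; apply: yk.
have ls : l <= k s by rewrite /k -ltnS prednK.
move: sumy; rewrite (sum_split_at k s) /d.
have -> : \sum_(j < m | s < j) (n j - 1) = \sum_(j < m | s < j) k j.
  by apply: eq_bigr => j _; rewrite subn1.
by clear -ls; move: (k s) (\sum_(j < m | s < j) k j) (\sum_(j < m | j < s) k j) ls; lia.
Qed.
End MinProd.

Unset Implicit Arguments.
Local Open Scope ring_scope.

Theorem mainTheorem13 (F : fieldType) (L : splittingFieldType F)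
  (m : nat) (n : 'I_m -> nat)
  (hn2 : forall j : 'I_m, (2 <= n j)%N)
  (hndec : forall j k : 'I_m, (j <= k)%N -> (n k <= n j)%N)
  (hgal : galois 1%AS {:L})
  (th : 'I_m -> gal_of {:L})
  (hthG : forall j : 'I_m, th j \in ('Gal({:L} / 1%AS))%g)
  (hcomm : forall j k : 'I_m, (th j * th k = th k * th j)%g)
  (hinj : injective (thetaPow th : Delta n -> gal_of {:L}))
  (hsurj : forall g, g \in ('Gal({:L} / 1%AS))%g -> exists i : Delta n, thetaPow th i = g)
  (P : {ffun gal_of {:L} -> L})
  (hPnz : exists2 g, g \in ('Gal({:L} / 1%AS))%g & P g != 0) :
  (minProd n (degTheta n th P) <= rkK P)%N /\
  (forall (s : 'I_m) (l : nat), (l < n s)%N ->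
     degTheta n th P = (\sum_(j < m | (s < j)%N) (n j - 1) + l)%N ->
     minProd n (degTheta n th P) = ((n s - l) * \prod_(j < m | (j < s)%N) n j)%N).
Proof.
have n_gt0 j : (0 < n j)%N by rewrite (leq_trans _ (hn2 j)).
split; last by move=> s l ltl ->; apply: minProd_eq.
have [u Pu leu] := rank_bound n_gt0 hthG hcomm hinj hsurj hPnz; apply: leq_trans leu.
(* The degree is attained, which makes it the total of an element of [Delta n], as [minProd_leq]
   requires. *)
have [i Pi Di] : exists2 i : Delta n, P (thetaPow th i) != 0%R & degTheta n th P = absidx i.
  have Pu0 : (0 < #|[pred i : Delta n | P (thetaPow th i) != 0%R]|)%N by apply/card_gt0P; exists u.
  by have [i Pi Di] := eq_bigmax_cond (@absidx m n) Pu0; exists i.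
by rewrite Di; apply: minProd_leq; rewrite -Di /degTheta (bigmax_sup u).
Qed.
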